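(* Let $K$ be an algebraically closed field and $R$ a finite dimensional $K$-algebra. Suppose that the underlying graph of the Ext quiver of $R$ is acyclic. If $M$ is an indecomposable multiplicity free $R$-module (of finite length) with lattice of submodules $\Lambda$, then $\mathrm{Ext}_\Lambda$ is the subgraph of $\mathrm{Ext}_R$ induced by $\mathrm{Supp}\, M$.
   Context: The Ext quiver of $R$ has as vertices the isomorphism classes of simple $R$-modules, with $\dim_K \mathrm{Ext}^1_R(x,y)$ arrows from $x$ to $y$. Its underlying graph is the undirected (multi)graph obtained by forgetting the orientation of arrows; it is acyclic if it has no cycles (in particular no loops and no multiple edges). $\mathrm{Ext}_R$ is the directed graph on the isomorphism classes of simple $R$-modules with an edge from $x$ to $y$ if and only if $\mathrm{Ext}^1_R(x,y)\neq 0$ (there is a nonsplit extension with submodule $y$ and quotient $x$). A module is multiplicity free if each of its composition factors occurs with multiplicity one. $\mathrm{Supp}\,M$ is the set of vertices (simple modules) that occur as composition factors of $M$. $\mathrm{Ext}_\Lambda$ is the directed graph whose vertices are the composition factors of $M$, with an edge from $x$ to $y$ if and only if there are submodules $W\subset V\subset U$ of $M$ such that $V$ is the unique submodule strictly between $W$ and $U$, $U/V\cong x$ and $V/W\cong y$. If $H$ is a subset of the vertex set of a digraph $G$, the subgraph of $G$ induced by $H$ has vertex set $H$ and has an arrow from $x$ to $y$ if and only if $G$ has one. *)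

(* Defs.v *)
From HB Require Import structures.
From mathcomp Require Import all_boot all_order all_algebra all_field.
From mathcomp Require Import boolp classical_sets functions.

Set Implicit Arguments.
Unset Strict Implicit.
Unset Printing Implicit Defensive.

Import GRing.Theory.
Local Open Scope ring_scope.
Local Open Scope quotient_scope.

(* An A-module is a left module [M : lmodType A], a submodule of M is a
   [U : submodClosed M], and U and V are the same submodule when [U =i V]. *)

Section Submodule.
Variables (A : pzRingType) (M : lmodType A).
Implicit Types U V : submodClosed M.

Record submod U : Type := Submod { submod_val : M; _ : submod_val \in U }.

HB.instance Definition _ U := [isSub for @submod_val U].
HB.instance Definition _ U := [Choice of submod U by <:].
HB.instance Definition _ U := [SubChoice_isSubLmodule of submod U by <:].

End Submodule.

Section Quotient.
Variables (A : pzRingType) (M : lmodType A).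
Implicit Types U V : submodClosed M.

(* U again, with the closure under subtraction that [Quotient.quot] needs. *)
Definition zpred U : {pred M} := U.

Fact zpred_zmod_closed U : zmod_closed (zpred U).
Proof. exact: GRing.submod_closedB (submodClosedP U). Qed.

HB.instance Definition _ U :=
  GRing.isZmodClosed.Build M (zpred U) (zpred_zmod_closed U).

Definition quotmod U : Type := Quotient.quot (zpred U : zmodClosed M).

HB.instance Definition _ U := GRing.Zmodule.on (quotmod U).
HB.instance Definition _ U := EqQuotient.on (quotmod U).

Definition quot_proj U (u : M) : quotmod U := \pi u.

Definition quot_scale U (a : A) (q : quotmod U) : quotmod U :=
  quot_proj U (a *: repr q).

Fact quot_projP U (u v : M) :
  reflect (quot_proj U u = quot_proj U v) (u - v \in U).
Proof.
rewrite -[u - v \in U]/(u - v \in zpred U) Quotient.idealrBE.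
exact: eqP.
Qed.

Fact quot_proj_repr U (q : quotmod U) : quot_proj U (repr q) = q.
Proof. exact: reprK. Qed.

Fact quot_projD U : {morph quot_proj U : u v / u + v}.
Proof. by move=> u v; apply: pi_addr. Qed.

Fact quot_projZ U (a : A) (u : M) :
  quot_scale a (quot_proj U u) = quot_proj U (a *: u).
Proof.
apply/quot_projP; rewrite -scalerBr rpredZ //.
by apply/quot_projP; rewrite quot_proj_repr.
Qed.

Fact quot_scalerA U (a b : A) (q : quotmod U) :
  quot_scale a (quot_scale b q) = quot_scale (a * b) q.
Proof. by rewrite -(quot_proj_repr q) !quot_projZ scalerA. Qed.

Fact quot_scale1r U : left_id 1 (@quot_scale U).
Proof. by move=> q; rewrite -(quot_proj_repr q) quot_projZ scale1r. Qed.

Fact quot_scalerDr U : right_distributive (@quot_scale U) +%R.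
Proof.
move=> a q r; rewrite -(quot_proj_repr q) -(quot_proj_repr r).
by rewrite -quot_projD !quot_projZ -quot_projD scalerDr.
Qed.

Fact quot_scalerDl U (q : quotmod U) :
  {morph (@quot_scale U)^~ q : a b / a + b}.
Proof.
move=> a b; rewrite -(quot_proj_repr q).
by rewrite !quot_projZ -quot_projD scalerDl.
Qed.

HB.instance Definition _ U := GRing.Zmodule_isLmodule.Build A (quotmod U)
  (@quot_scalerA U) (@quot_scale1r U) (@quot_scalerDr U) (@quot_scalerDl U).

Fact quot_proj_is_linear U : linear (quot_proj U).
Proof. by move=> a u v; rewrite quot_projD -quot_projZ. Qed.

HB.instance Definition _ U := GRing.isLinear.Build A M (quotmod U) _
  (quot_proj U) (quot_proj_is_linear U).

End Quotient.

Section Subquotient.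
Variables (A : pzRingType) (M : lmodType A).
Implicit Types U V : submodClosed M.

(* The intersection of U and V, as a submodule of U. *)
Definition trace_pred U V : {pred submod U} := [pred u | val u \in V].
Arguments trace_pred : clear implicits.

Fact trace_submod_closed U V : submod_closed (trace_pred U V).
Proof.
split=> [|a u v]; rewrite !inE ?raddf0 ?rpred0 // => uV vV.
by rewrite linearD linearZ rpredD ?rpredZ.
Qed.

HB.instance Definition _ U V := GRing.isSubmodClosed.Build A (submod U)
  (trace_pred U V) (GRing.submod_closed_semi (trace_submod_closed U V)).

(* The quotient of U by its intersection with V: U / V when V lies in U. *)
Definition subquot U V : lmodType A :=
  quotmod (trace_pred U V : submodClosed (submod U)).

End Subquotient.

Section Modules.
Variable A : pzRingType.
Implicit Types M N S : lmodType A.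

Definition isomorphic M N : Prop := exists f : {linear M -> N}, bijective f.

Definition zero_submod M (U : submodClosed M) : Prop := U =i pred1 0.
Definition full_submod M (U : submodClosed M) : Prop := U =i predT.

Definition proper_submod M (U V : submodClosed M) : Prop :=
  {subset U <= V} /\ ~ {subset V <= U}.

Definition simple M : Prop :=
  (exists u : M, u != 0) /\
  forall U : submodClosed M, zero_submod U \/ full_submod U.

Definition indecomposable M : Prop :=
  (exists u : M, u != 0) /\
  forall U V : submodClosed M,
    (forall w : M, exists2 u, u \in U & exists2 v, v \in V & w = u + v) ->
    (forall w : M, w \in U -> w \in V -> w = 0) ->
    zero_submod U \/ zero_submod V.

(* 0 = c 0 < c 1 < ... < c n = M; the values c i with i > n are irrelevant. *)
Definition composition_series M (n : nat) (c : nat -> submodClosed M) : Prop :=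
  [/\ zero_submod (c 0%N), full_submod (c n)
    & forall i, (i < n)%N ->
        {subset c i <= c i.+1} /\ simple (subquot (c i.+1) (c i))].

Definition finite_length M : Prop :=
  exists n (c : nat -> submodClosed M), composition_series n c.

Definition composition_factor M S : Prop :=
  exists n (c : nat -> submodClosed M) i,
    [/\ composition_series n c, (i < n)%N
      & isomorphic (subquot (c i.+1) (c i)) S].

Definition multiplicity_free M : Prop :=
  forall n (c : nat -> submodClosed M), composition_series n c ->
  forall i j, (i < j < n)%N ->
  ~ isomorphic (subquot (c i.+1) (c i)) (subquot (c j.+1) (c j)).

End Modules.

Record digraph (T : Type) := Digraph {
  vertex : T -> Prop;
  arrow : T -> T -> Prop  (* meaningful between vertices only *)
}.

Definition same_digraph T (G H : digraph T) : Prop :=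
  (forall x, vertex G x <-> vertex H x) /\
  (forall x y, vertex G x -> vertex G y -> (arrow G x y <-> arrow H x y)).

Definition induced T (G : digraph T) (H : T -> Prop) : digraph T :=
  Digraph H (arrow G).

(* Ext_Lambda, for Lambda the lattice of submodules of M. *)
Definition lattice_ext_digraph (A : pzRingType) (M : lmodType A) :
    digraph (lmodType A) :=
  Digraph (composition_factor M) (fun x y =>
    exists W V U : submodClosed M,
      [/\ proper_submod W V /\ proper_submod V U,
          forall V' : submodClosed M,
            proper_submod W V' -> proper_submod V' U -> V' =i V,
          isomorphic (subquot U V) x
        & isomorphic (subquot V W) y]).

Section Ext1.
Variables (K : fieldType) (R : falgType K).

Definition restrict (M : lmodType R) : Type := M.

Section Restrict.
Variable M : lmodType R.

HB.instance Definition _ := GRing.Zmodule.on (restrict M).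

Definition restrict_scale (k : K) (u : restrict M) : restrict M :=
  (k%:A : R) *: (u : M).

Fact restrict_scalerA (a b : K) (u : restrict M) :
  restrict_scale a (restrict_scale b u) = restrict_scale (a * b) u.
Proof. by rewrite /restrict_scale scalerA -scalerAl mul1r scalerA. Qed.

Fact restrict_scale1r : left_id 1 restrict_scale.
Proof. by move=> u; rewrite /restrict_scale !scale1r. Qed.

Fact restrict_scalerDr : right_distributive restrict_scale +%R.
Proof. by move=> a u v; rewrite /restrict_scale scalerDr. Qed.

Fact restrict_scalerDl (u : restrict M) :
  {morph restrict_scale^~ u : a b / a + b}.
Proof. by move=> a b; rewrite /restrict_scale !scalerDl. Qed.

HB.instance Definition _ := GRing.Zmodule_isLmodule.Build K (restrict M)
  restrict_scalerA restrict_scale1r restrict_scalerDr restrict_scalerDl.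

Fact restrict_scaleC (k : K) (a : R) (u : restrict M) :
  a *: (k *: u : M) = k *: (a *: (u : M) : restrict M) :> M.
Proof.
rewrite -[_ *: u]/(k%:A *: (u : M)) -[RHS]/(k%:A *: (a *: (u : M))).
by rewrite !scalerA -scalerAl -scalerAr mul1r mulr1.
Qed.
End Restrict.

Variables x y : lmodType R.

(* Ext^1_R(x, y) is the first cohomology of the complex
     Hom_K(x, y) -> Hom_K(R, Hom_K(x, y)) -> Hom_K(R (x) R, Hom_K(x, y))
   obtained by applying Hom_R(-, y) to the bar resolution of x.  The class of
   the cocycle d is that of the extension of x by y given by the K-space y + x
   with the action a (w, v) = (a w + d a v, a v). *)
Definition cochain : lmodType K := R -> restrict x -> restrict y.

Definition is_cocycle (d : R -> restrict x -> restrict y) : Prop :=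
  [/\ linear d, forall a, linear (d a)
    & forall (a b : R) (v : x),
        d (a * b) v = (a *: (d b v : y) + d a (b *: v)) :> y].

Definition is_coboundary (d : R -> restrict x -> restrict y) : Prop :=
  exists h : {linear restrict x -> restrict y},
    forall (a : R) (v : x), d a v = (a *: (h v : y) - h (a *: v)) :> y.

Definition cocycle : {pred cochain} := [pred d | `[< is_cocycle d >]].
Definition coboundary : {pred cochain} := [pred d | `[< is_coboundary d >]].

Fact cochainE (k : K) (d e : cochain) a v :
  (k *: d + e) a v = k *: d a v + e a v.
Proof. by []. Qed.

Fact cocycle_submod_closed : submod_closed cocycle.
Proof.
split=> [|k d e /asboolP[dl dvl dM] /asboolP[el evl eM]]; apply/asboolP.
  by split=> [l a b|a l u v|a b v]; rewrite ?scaler0 ?addr0.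
have addZ (l : K) (p q r s : restrict y) :
    k *: (l *: p + q) + (l *: r + s) = l *: (k *: p + r) + (k *: q + s).
  by rewrite !scalerDr addrACA !scalerA [k * l]mulrC.
split=> [l a b|a l u v|a b v]; last first.
- by rewrite !cochainE dM eM !scalerDr -addrACA restrict_scaleC.
- by rewrite !cochainE dvl evl addZ.
by apply/funext => v; rewrite cochainE dl el; apply: addZ.
Qed.

Fact coboundary_submod_closed : submod_closed coboundary.
Proof.
split=> [|k d e /asboolP[f df] /asboolP[g eg]]; apply/asboolP.
  by exists \0 => a v; rewrite scaler0 subr0.
exists (k \*: f \+ g) => a v; rewrite cochainE.
have -> : d a v = a *: (f v : y) - f (a *: v) by exact: df.
have -> : e a v = a *: (g v : y) - g (a *: v) by exact: eg.
by rewrite [_ *: (_ - _)]scalerBr /= scalerDr restrict_scaleC opprD addrACA.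
Qed.

HB.instance Definition _ := GRing.isSubmodClosed.Build K cochain cocycle
  (GRing.submod_closed_semi cocycle_submod_closed).
HB.instance Definition _ := GRing.isSubmodClosed.Build K cochain coboundary
  (GRing.submod_closed_semi coboundary_submod_closed).

Definition Ext1 : lmodType K := subquot cocycle coboundary.

(* [Ext1_dim n] says that Ext^1_R(x, y) has dimension n over K. *)
Definition Ext1_dim (n : nat) : Prop := isomorphic 'rV[K]_n Ext1.

Definition Ext1_nonzero : Prop := exists e : Ext1, e != 0.

End Ext1.

Definition ext_digraph (K : fieldType) (R : falgType K) :
    digraph (lmodType R) :=
  Digraph (@simple R) (@Ext1_nonzero K R).

(* In the underlying graph of the Ext quiver a vertex x carries dim Ext^1(x, x)
   loops, and distinct vertices x and y are joined by
   dim Ext^1(x, y) + dim Ext^1(y, x) edges.  The clauses exclude the cycles of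
   length 1, 2 and at least 3 in turn.  Vertices are isomorphism classes, so
   "distinct" means non-isomorphic. *)
Definition acyclic_ext_quiver (K : fieldType) (R : falgType K) : Prop :=
  [/\ forall x : lmodType R, simple x -> Ext1_dim x x 0,
      forall x y : lmodType R, simple x -> simple y -> ~ isomorphic x y ->
        exists m n, [/\ Ext1_dim x y m, Ext1_dim y x n & (m + n <= 1)%N]
    & forall n (s : 'I_n -> lmodType R), (2 < n)%N ->
        (forall i, simple (s i)) ->
        (forall i j, isomorphic (s i) (s j) -> i = j) ->
        ~ forall i, arrow (ext_digraph R) (s i) (s (ordS i)) \/
                    arrow (ext_digraph R) (s (ordS i)) (s i)].

(* Main.v *)
Require Import Defs.
From HB Require Import structures.
From mathcomp Require Import all_boot all_order all_algebra all_field.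
From mathcomp Require Import boolp.

(* A Lambda-arrow x -> y comes from a length-two subquotient with a unique
   composition series, that is, from a nonsplit extension of x by y, so that
   Ext_Lambda is always a subgraph of Ext_R.  Conversely, Ext_Lambda is
   connected: if no arrow joined a set S of factors of a composition series to
   its complement, then every term of the series would be the sum of a
   submodule with factors in S and one with factors outside S; as the factors
   are distinct, the two submodules for M itself would form a direct
   decomposition.  An arrow x -> y of Ext_R outside Ext_Lambda would therefore
   close a path of Ext_Lambda from x to y into a cycle of the Ext quiver. *)

Set Implicit Arguments.
Unset Strict Implicit.
Unset Printing Implicit Defensive.

Import GRing.Theory.
Local Open Scope ring_scope.

(** * Isomorphisms of modules and invariance of simplicity *)

Section Isomorphism.
Variable A : pzRingType.
Implicit Types M N S : lmodType A.

Lemma isomorphic_refl M : isomorphic M M.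
Proof. by exists idfun; exists id. Qed.

Lemma isomorphic_sym M N : isomorphic M N -> isomorphic N M.
Proof.
case=> f [g fK gK].
have gl : linear g.
  by move=> a u v; apply: (can_inj fK); rewrite linearP !gK.
pose gL := GRing.isLinear.Build A N M _ g gl.
pose g' : {linear N -> M} := HB.pack g gL.
by exists g'; exists f.
Qed.

Lemma isomorphic_trans N M S :
  isomorphic M N -> isomorphic N S -> isomorphic M S.
Proof.
move=> [f f_bij] [g g_bij]; exists (g \o f : {linear _ -> _}).
exact: bij_comp.
Qed.

Lemma simple_isomorphic M N : isomorphic M N -> simple M -> simple N.
Proof.
move=> [f [g fK gK]] [[u u_neq0] M_simple]; split.
  exists (f u); apply: contra_neq u_neq0 => fu0.
  by apply: (can_inj fK); rewrite fu0 raddf0.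
move=> U; pose P : {pred M} := [pred v | f v \in U].
have Pcl : submod_closed P.
  split=> [|a v w]; rewrite !inE ?raddf0 ?rpred0 // => vU wU.
  by rewrite linearP rpredD ?rpredZ.
pose PL := GRing.isSubmodClosed.Build A M P (GRing.submod_closed_semi Pcl).
pose P' : submodClosed M := HB.pack P PL.
have PE v : (v \in P') = (f v \in U) by [].
case: (M_simple P') => [P0|PT]; [left|right] => v; rewrite -[v]gK -PE.
  by rewrite P0 !inE -(inj_eq (can_inj fK)) raddf0.
exact: PT.
Qed.

End Isomorphism.

(** * Submodules cut out by propositional predicates *)

Section Comprehension.
Variables (A : pzRingType) (M : lmodType A) (P : M -> Prop).
Hypothesis P0 : P 0.
Hypothesis PZD : forall a u v, P u -> P v -> P (a *: u + v).

(** Membership in a submodule is boolean, so the predicate is decided classically. Images, preimages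
    and kernels are formed this way below. *)
Lemma submod_comprehension :
  exists U : submodClosed M, forall u, u \in U <-> P u.
Proof.
pose p : {pred M} := [pred u | `[< P u >]].
have pcl : submod_closed p.
  split=> [|a u v]; rewrite !inE; first exact/asboolP.
  by move=> /asboolP Pu /asboolP Pv; apply/asboolP/PZD.
pose pL := GRing.isSubmodClosed.Build A M p (GRing.submod_closed_semi pcl).
exists (HB.pack_for (submodClosed M) p pL) => u.
by split=> [/asboolP|Pu] //; apply/asboolP.
Qed.

End Comprehension.

(** * Lattice operations, isomorphism theorems and simple subquotients *)

Section Submodules.
Variables (A : pzRingType) (M : lmodType A).
Implicit Types U V W X : submodClosed M.

Lemma submodN U u : u \in U -> - u \in U.
Proof. by move=> uU; rewrite -scaleN1r rpredZ. Qed.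

Lemma submodB U u v : u \in U -> v \in U -> u - v \in U.
Proof. by move=> uU vU; rewrite rpredD ?submodN. Qed.


Definition capsm_pred U V : {pred M} := [pred u | (u \in U) && (u \in V)].
Arguments capsm_pred : clear implicits.

Fact capsm_closed U V : submod_closed (capsm_pred U V).
Proof.
split=> [|a u v]; rewrite !inE ?rpred0 // => /andP[uU uV] /andP[vU vV].
by rewrite !rpredD ?rpredZ.
Qed.

HB.instance Definition _ U V := GRing.isSubmodClosed.Build A M
  (capsm_pred U V) (GRing.submod_closed_semi (capsm_closed U V)).

Definition capsm U V : submodClosed M := capsm_pred U V.

Definition addsm_pred U V : {pred M} :=
  [pred w | `[< exists2 u, u \in U & w - u \in V >]].
Arguments addsm_pred : clear implicits.

Fact addsm_closed U V : submod_closed (addsm_pred U V).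
Proof.
split=> [|a w z]; rewrite !inE.
  by apply/asboolP; exists 0; rewrite ?subr0 rpred0.
move=> /asboolP[u uU uV] /asboolP[v vU vV]; apply/asboolP.
exists (a *: u + v); first by rewrite rpredD ?rpredZ.
by rewrite opprD addrACA -scalerBr rpredD ?rpredZ.
Qed.

HB.instance Definition _ U V := GRing.isSubmodClosed.Build A M
  (addsm_pred U V) (GRing.submod_closed_semi (addsm_closed U V)).

Definition addsm U V : submodClosed M := addsm_pred U V.

Lemma in_capsm U V u : (u \in capsm U V) = (u \in U) && (u \in V).
Proof. by []. Qed.

Lemma addsmP U V w :
  reflect (exists2 u, u \in U & exists2 v, v \in V & w = u + v)
          (w \in addsm U V).
Proof.
apply: (iffP (asboolP _)) => [[u uU wuV]|[u uU [v vV ->]]]; exists u => //.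
  by exists (w - u) => //; rewrite addrC subrK.
by rewrite addrAC subrr add0r.
Qed.

Lemma addsml U V : {subset U <= addsm U V}.
Proof. by move=> u uU; apply/addsmP; exists u => //; exists 0;
  rewrite ?addr0 ?rpred0. Qed.

Lemma addsmr U V : {subset V <= addsm U V}.
Proof. by move=> v vV; apply/addsmP; exists 0; rewrite ?rpred0 //; exists v;
  rewrite ?add0r. Qed.

Lemma addsm_sub U V W :
  {subset U <= W} -> {subset V <= W} -> {subset addsm U V <= W}.
Proof.
by move=> UW VW _ /addsmP[u /UW uW [v /VW vW ->]]; rewrite rpredD.
Qed.

Lemma not_subset_ex U V : ~ {subset U <= V} -> exists2 u, u \in U & u \notin V.
Proof.
move=> UV; apply: contra_notP UV => noU u uU; apply/negPn/negP => uV.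
by apply: noU; exists u.
Qed.

Definition subquot_proj U V : {linear submod U -> subquot U V} :=
  @quot_proj A (submod U) (@trace_pred A M U V).

Lemma subquot_proj_surj U V q : exists u, subquot_proj U V u = q.
Proof. by exists (repr q); apply: quot_proj_repr. Qed.

Lemma subquot_proj_eq0 U V u : (subquot_proj U V u = 0) <-> (val u \in V).
Proof.
rewrite -(raddf0 (subquot_proj U V)) -[val u \in V]/(u \in @trace_pred A M U V).
by rewrite -{2}[u]subr0; split=> /quot_projP.
Qed.

(** First isomorphism theorem: [f] is evaluated on representatives, which is well defined because
    two elements have the same class exactly when they have the same image. *)
Lemma subquot_isomorphic (N : lmodType A) U V (f : {linear submod U -> N}) :
    (forall w, exists u, f u = w) -> (forall u, f u = 0 <-> val u \in V) ->
  isomorphic (subquot U V) N.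
Proof.
move=> f_surj f_ker.
pose p := subquot_proj U V.
have eq_ker u v : (p u = p v) <-> (f u = f v).
  have : p (u - v) = 0 <-> f (u - v) = 0.
    by rewrite f_ker; apply: subquot_proj_eq0.
  rewrite !raddfB => -[pf fp].
  by split=> /eqP; rewrite -subr_eq0 => /eqP; [move/pf | move/fp] => /subr0_eq.
pose g (q : quotmod (@trace_pred A M U V)) := f (repr q).
have gp u : g (p u) = f u by apply/eq_ker/quot_proj_repr.
have gl : linear g.
  move=> a q r; have [u <-] := subquot_proj_surj q.
  by have [v <-] := subquot_proj_surj r; rewrite -linearP !gp linearP.
pose gL := GRing.isLinear.Build A (subquot U V) N _ g gl.
pose g' : {linear subquot U V -> N} := HB.pack g gL.
pose h w := p (sval (cid (f_surj w))).
exists g', h => [q|w]; rewrite /h; case: cid => u /=; last by rewrite gp.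
by have [v <-] := subquot_proj_surj q; rewrite gp => /eq_ker.
Qed.

(** Composing the isomorphism with the projection gives a surjection defined on [U] itself, so that
    later computations need not enter the quotient type. *)
Lemma isomorphic_subquot (N : lmodType A) U V :
    isomorphic (subquot U V) N ->
  exists2 f : {linear submod U -> N},
    (forall w, exists u, f u = w) & (forall u, f u = 0 <-> val u \in V).
Proof.
move=> [f [g fK gK]]; exists (f \o subquot_proj U V : {linear _ -> _}) => [w|u].
  by have [u pu] := subquot_proj_surj (g w); exists u; rewrite /= pu.
rewrite -subquot_proj_eq0 /= -(raddf0 f).
by split=> [/(can_inj fK)|->].
Qed.

(* Second isomorphism theorem, with U' + V = U and V' = U' \cap V. *)
Lemma subquot_isomorphic_sub U V U' V' :
    {subset U' <= U} -> {subset U <= addsm U' V} ->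
    (forall u, u \in U' -> (u \in V') = (u \in V)) ->
  isomorphic (subquot U' V') (subquot U V).
Proof.
move=> U'U UU'V V'E.
pose i (u : submod U') : submod U := Submod (U'U _ (valP u)).
have il : linear i by move=> a u v; apply: val_inj.
pose iL := GRing.isLinear.Build A (submod U') (submod U) _ i il.
pose i' : {linear submod U' -> submod U} := HB.pack i iL.
apply: (@subquot_isomorphic _ _ _ (subquot_proj U V \o i' : {linear _ -> _})).
  move=> q; have [u <-] := subquot_proj_surj q.
  have /addsmP[u' u'U' [v vV uE]] := UU'V _ (valP u).
  exists (Submod u'U'); apply: subr0_eq; rewrite /= -raddfB.
  by apply/subquot_proj_eq0; rewrite raddfB /= uE opprD addrA subrr add0r;
    apply: submodN.
by move=> u; rewrite V'E ?(valP u) //; apply: subquot_proj_eq0.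
Qed.

(** Correspondence theorem: submodules of U / V are the images of the X between V and U, so
    simplicity becomes a condition on the lattice of submodules. *)
Lemma simple_subquotP U V : {subset V <= U} ->
  simple (subquot U V) <->
  ~ {subset U <= V} /\ (forall X, {subset V <= X} -> {subset X <= U} ->
     {subset X <= V} \/ {subset U <= X}).
Proof.
move=> VU; split=> [UV_simple|[UV max_V]].
  split=> [UV|X VX XU].
    have [[q /eqP q_neq0] _] := UV_simple; apply: q_neq0.
    have [u <-] := subquot_proj_surj q.
    by apply/subquot_proj_eq0/UV/(valP u).
  have [||Q QE] := @submod_comprehension A (subquot U V)
      (fun r => exists2 u, subquot_proj U V u = r & val u \in X).
  - by exists 0; rewrite ?raddf0 ?rpred0.
  - move=> a ? ? [u <- uX] [v <- vX]; exists (a *: u + v); rewrite linearP //.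
    by rewrite rpredD ?rpredZ.
  have [_ /(_ Q) [Q0|QT]] := UV_simple; [left=> u uX|right=> u uU].
    have uU := XU _ uX; rewrite -[u]/(val (Submod uU)); apply/subquot_proj_eq0.
    by apply/eqP; rewrite -[_ == 0]/(_ \in pred1 0) -Q0; apply/QE;
      exists (Submod uU).
  have /QE[v /eqP] : subquot_proj U V (Submod uU) \in Q by rewrite QT.
  rewrite -subr_eq0 -raddfB => /eqP/subquot_proj_eq0 /= /VX vuX vX.
  by have := submodB vX vuX; rewrite opprB addrC subrK.
split.
  have [u uU uV] := not_subset_ex UV.
  exists (subquot_proj U V (Submod uU)); apply: contraNneq uV.
  by move/subquot_proj_eq0.
move=> Q; have [||X XE] := @submod_comprehension _ M
    (fun u => exists2 v : submod U, val v = u & subquot_proj U V v \in Q).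
- by exists 0; rewrite ?raddf0 ?rpred0.
- move=> a _ _ [u <- uQ] [v <- vQ]; exists (a *: u + v) => //.
  by rewrite linearP rpredD ?rpredZ.
have VX : {subset V <= X}.
  move=> u uV; apply/XE; exists (Submod (VU _ uV)) => //.
  by rewrite (_ : subquot_proj U V _ = 0) ?rpred0 //; apply/subquot_proj_eq0.
have XU : {subset X <= U} by move=> _ /XE[v <- _]; apply: (valP v).
have [XV|UX] := max_V X VX XU; [left|right] => q;
  have [u <-] := subquot_proj_surj q.
  rewrite inE; apply/idP/eqP => [uQ|->]; last exact: rpred0.
  by apply/subquot_proj_eq0/XV/XE; exists u.
rewrite inE; have /XE[v /val_inj <- //] := UX _ (valP u).
Qed.

End Submodules.

(** * Length of submodules, and maximal and minimal submodules *)

Section Length.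
Variables (A : pzRingType) (M : lmodType A).
Variables (n : nat) (c : nat -> submodClosed M).
Hypothesis c_series : composition_series n c.
Implicit Types U V X : submodClosed M.

(** Equivalently, U \cap c_{i+1} has nonzero image in c_{i+1} / c_i. As this quotient is simple for
    i < n, the image is then everything, and counting such [i] gives the length of [U]. *)
Definition meets_factor U (i : nat) : Prop :=
  exists u, [/\ u \in U, u \in c i.+1 & u \notin c i].

Definition sm_length U : nat := (\sum_(i < n) `[< meets_factor U i >])%N.

Lemma sm_length_bound U : (sm_length U <= n)%N.
Proof.
by rewrite -[leqRHS]card_ord -sum1_card leq_sum // => i _; apply: leq_b1.
Qed.

Lemma meets_factor_sub U V i :
  {subset U <= V} -> meets_factor U i -> meets_factor V i.
Proof. by move=> UV [u [/UV uV uc uc']]; exists u. Qed.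

(** If [U] and [V] met the same factors, V \cap c_i would lie in U for all i, by induction: an
    element of V \cap c_{i+1} outside c_i differs from one of U \cap c_{i+1} by an element of c_i,
    which lies in V because U does. *)
Lemma sm_length_lt U V : proper_submod U V -> (sm_length U < sm_length V)%N.
Proof.
move=> [UV VU].
have le_i (i : 'I_n) : (`[< meets_factor U i >] <= `[< meets_factor V i >])%N.
  case: asboolP => [/(meets_factor_sub UV) Vi|_]; last exact: leq0n.
  by rewrite asboolT.
rewrite ltn_neqAle leq_sum ?andbT; last by move=> i _; apply: le_i.
apply/eqP => eq_len; apply: VU.
have eq_i (i : 'I_n) : meets_factor V i -> meets_factor U i.
  have := eq_leq (esym eq_len); rewrite /sm_length (bigD1 i) //=.
  rewrite [leqRHS](bigD1 i) //= => le_len.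
  case: (asboolP (meets_factor U i)) le_len => // _; case: asboolP => // _.
  rewrite add0n add1n ltnNge => /negP[].
  by apply: leq_sum => j _; apply: le_i.
have [c0 cn c_step] := c_series.
suff VU i : (i <= n)%N -> forall v, v \in V -> v \in c i -> v \in U.
  by move=> v vV; apply: (VU n) => //; rewrite cn.
elim: i => [_ v _|i IH lt_in v vV vc]; first by rewrite c0 inE => /eqP->;
  rewrite rpred0.
have [vci|vci] := boolP (v \in c i); first by apply: IH => //; apply: ltnW.
have /(eq_i (Ordinal lt_in)) [u [uU uc uci]] : meets_factor V (Ordinal lt_in)
  by exists v.
have [ci_sub /(simple_subquotP ci_sub) [_ max_c]] := c_step i lt_in.
have [||ucV|cuV] := max_c (addsm (c i) (capsm U (c i.+1))).
- exact: addsml.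
- by apply: addsm_sub => // w; rewrite in_capsm => /andP[].
- by case/negP: uci; apply: ucV; apply: addsmr; rewrite in_capsm uU.
have /addsmP[a ac [b]] := cuV v vc; rewrite in_capsm => /andP[bU bc] vE.
rewrite vE rpredD // (IH (ltnW lt_in)) //.
by move: vE => /(congr1 (fun w => w - b)); rewrite addrK => <-;
  rewrite submodB // UV.
Qed.

(** Lengths are bounded by [n] and strictly monotone, so a member of [Q] of greatest length is
    maximal. *)
Lemma maximal_submod (Q : submodClosed M -> Prop) U : Q U ->
  exists2 V, Q V & forall X : submodClosed M,
    Q X -> {subset V <= X} -> {subset X <= V}.
Proof.
move=> QU; pose p k := `[< exists2 V, Q V & sm_length V = k >].
have p_ex : exists k, p k by exists (sm_length U); apply/asboolP; exists U.
have p_le k : p k -> (k <= n)%N.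
  by move=> /asboolP[V _ <-]; apply: sm_length_bound.
case: (ex_maxnP p_ex p_le) => k /asboolP[V QV <-] max_V.
exists V => // X QX VX; apply: contrapT => XV.
have /sm_length_lt : proper_submod V X by [].
by rewrite ltnNge max_V //; apply/asboolP; exists X.
Qed.

Lemma minimal_submod (Q : submodClosed M -> Prop) U : Q U ->
  exists2 V, Q V & forall X : submodClosed M,
    Q X -> {subset X <= V} -> {subset V <= X}.
Proof.
move=> QU; pose p k := `[< exists2 V, Q V & sm_length V = k >].
have p_ex : exists k, p k by exists (sm_length U); apply/asboolP; exists U.
case: (ex_minnP p_ex) => k /asboolP[V QV <-] min_V.
exists V => // X QX XV; apply: contrapT => VX.
have /sm_length_lt : proper_submod X V by [].
by rewrite ltnNge min_V //; apply/asboolP; exists X.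
Qed.

Lemma maximal_proper_submod U V : proper_submod U V ->
  exists2 X : submodClosed M, {subset U <= X} & {subset X <= V} /\ simple
    (subquot V X).
Proof.
move=> [UV VU].
have [|X [UX XV VX] max_X] := maximal_submod
  (Q := fun X : submodClosed M => [/\ {subset U <= X}, {subset X <= V} & ~
    {subset V <= X}]) (U := U).
  by split.
exists X => //; split=> //; apply/simple_subquotP => //; split=> // Y XY YV.
have [VY|VY] := pselect {subset V <= Y}; [by right | left].
by apply: max_X => //; split=> // u /UX/XY.
Qed.

End Length.

(** * Submodules with composition factors in a given set *)

Section Factors.
Variables (A : pzRingType) (M : lmodType A).
Variables (I : Type) (s : I -> lmodType A).
Implicit Types (S T : I -> Prop) (U V N : submodClosed M).

(** Quantifying over all simple subquotients, and not over one series of [N], makes the property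
    pass to submodules at once. *)
Definition factors_in S N : Prop :=
  forall U V, {subset V <= U} -> {subset U <= N} -> simple (subquot U V) ->
  exists2 i, S i & isomorphic (subquot U V) (s i).

Lemma factors_in_sub S N N' :
  {subset N <= N'} -> factors_in S N' -> factors_in S N.
Proof. by move=> NN' SN' U V VU UN; apply: SN' => // u /UN/NN'. Qed.

Lemma factors_in_zero S N : zero_submod N -> factors_in S N.
Proof.
move=> N0 U V VU UN /(simple_subquotP VU) [[]] u /UN.
by rewrite N0 inE => /eqP->; rewrite rpred0.
Qed.

(** A simple U / V inside N' either has U \cap N inside V, and is then isomorphic to N' / N, or is
    covered by U \cap N, and is then isomorphic to the subquotient of N by U \cap N and V \cap N. *)
Lemma factors_in_ext S N N' i :
    S i -> {subset N <= N'} -> simple (subquot N' N) ->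
    isomorphic (subquot N' N) (s i) -> factors_in S N -> factors_in S N'.
Proof.
move=> Si NN' simpleN isoN SN U V VU UN' UVs.
have [_ max_N] := (simple_subquotP NN').1 simpleN.
have [nUV max_V] := (simple_subquotP VU).1 UVs.
have [capV|capnV] := pselect {subset capsm U N <= V}.
  have between (X : submodClosed M) : {subset X <= N'} -> {subset X <= N} \/
    {subset N' <= addsm X N}.
    move=> XN'; have [||XN|] := max_N (addsm X N); last by right.
    - exact: addsmr.
    - exact: addsm_sub.
    - by left=> x xX; apply/XN/addsml.
  have [UN|N'U] := between U UN'.
    by case: nUV => u uU; apply: capV; rewrite in_capsm uU UN.
  exists i => //; apply: isomorphic_trans isoN.
  apply: subquot_isomorphic_sub => // u uU; apply/idP/idP => [uV|uN].
    (* If V + N = N', the modular law gives U = V + (U \cap N), which lies in V, against the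
       simplicity of U / V. *)
    have [VN|N'V] := between V (fun v vV => UN' v (VU v vV)); first exact: VN.
    case: nUV => {uV}u {}uU; have /addsmP[v vV [w wN uE]] := N'V _ (UN' _ uU).
    rewrite uE rpredD //; apply: capV; rewrite in_capsm wN andbT.
    by rewrite -(addKr v w) -uE addrC submodB // VU.
  by apply: capV; rewrite in_capsm uU.
have [||capV|UV] := max_V (addsm (capsm U N) V).
- exact: addsmr.
- by apply: addsm_sub => // u; rewrite in_capsm => /andP[].
- by case: capnV => u uUN; apply/capV/addsml.
have iso : isomorphic (subquot (capsm U N) (capsm V N)) (subquot U V).
  apply: subquot_isomorphic_sub => // u; rewrite !in_capsm => /andP[] // _ ->.
  by rewrite andbT.
have [|||j Sj isoj] := SN (capsm U N) (capsm V N).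
- by move=> v; rewrite !in_capsm => /andP[/VU-> ->].
- by move=> v; rewrite in_capsm => /andP[].
- exact: simple_isomorphic (isomorphic_sym iso) UVs.
by exists j => //; apply: isomorphic_trans isoj; apply: isomorphic_sym.
Qed.

Lemma subquot_factors_in S N N' V :
    {subset N' <= N} -> {subset N <= addsm N' V} -> factors_in S N' ->
    {subset V <= N} -> simple (subquot N V) ->
  exists2 i, S i & isomorphic (subquot N V) (s i).
Proof.
move=> N'N NN'V SN' VN simpleN.
have iso : isomorphic (subquot N' (capsm N' V)) (subquot N V).
  by apply: subquot_isomorphic_sub => // u uN'; rewrite in_capsm uN'.
have [|||i Si isoi] := SN' N' (capsm N' V) => //.
- by move=> u; rewrite in_capsm => /andP[].
- exact: simple_isomorphic (isomorphic_sym iso) simpleN.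
by exists i => //; apply: isomorphic_trans isoi; apply: isomorphic_sym.
Qed.

End Factors.

(** * Extending a splitting by one factor *)

Section Splitting.
Variables (A : pzRingType) (M : lmodType A).
Variables (n : nat) (c : nat -> submodClosed M).
Hypothesis c_series : composition_series n c.
Variables (I : Type) (s : I -> lmodType A).
Implicit Types (S T : I -> Prop) (U V N : submodClosed M).

(* A minimal X between U and N' with X + N = N' meets N in U only: otherwise,
   for a maximal D' with U <= D' < D = X \cap N, minimality makes D the only
   submodule strictly between D' and X, since any other one, added to D, would
   give X.  This is an arrow from X / D = N' / N to D / D', a factor of V. *)
Lemma split_step S T N N' U V i :
    S i -> (forall j, T j -> ~ arrow (lattice_ext_digraph M) (s i) (s j)) ->
    {subset U <= N} -> {subset N <= addsm U V} -> {subset V <= N} ->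
    factors_in s S U -> factors_in s T V ->
    {subset N <= N'} -> simple (subquot N' N) ->
    isomorphic (subquot N' N) (s i) ->
  exists X : submodClosed M,
    [/\ {subset X <= N'}, {subset N' <= addsm X V} & factors_in s S X].
Proof.
move=> Si no_arrow UN NUV VN SU TV NN' simpleN isoN.
have [nN'N max_N] := (simple_subquotP NN').1 simpleN.
have [|X [UX XN' N'X] min_X] := minimal_submod c_series
  (Q := fun X : submodClosed M =>
    [/\ {subset U <= X}, {subset X <= N'} & {subset N' <= addsm X N}])
  (U := N').
  by split=> // u; [move/UN/NN' | apply: addsml].
pose D := capsm X N.
have DX : {subset D <= X} by move=> u; rewrite in_capsm => /andP[].
have DN : {subset D <= N} by move=> u; rewrite in_capsm => /andP[].
have UD : {subset U <= D} by move=> u uU; rewrite in_capsm UX ?UN.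
have isoD : isomorphic (subquot X D) (subquot N' N).
  by apply: subquot_isomorphic_sub => // u uX; rewrite in_capsm uX.
have simpleD := simple_isomorphic (isomorphic_sym isoD) simpleN.
have [nXD max_D] := (simple_subquotP DX).1 simpleD.
(* If D = U, then X / U is isomorphic to N' / N, so X adds only the factor [s i] to U, and N' = X +
   N = X + U + V = X + V. *)
have [DU|nDU] := pselect {subset D <= U}.
  have UE : isomorphic (subquot X U) (subquot X D).
    apply: subquot_isomorphic_sub => // [u|u uX]; first exact: addsml.
    by apply/idP/idP => [/UD|/DU].
  exists X; split=> // [u /N'X/addsmP[x xX [w /NUV /addsmP[u' uU [v vV ->]]
    ->]]|].
    by apply/addsmP; exists (x + u'); [rewrite rpredD // UX | exists v;
      rewrite ?addrA].
  apply: (factors_in_ext Si UX) SU.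
    exact: simple_isomorphic (isomorphic_sym UE) simpleD.
  exact: isomorphic_trans UE (isomorphic_trans isoD isoN).
have [D' UD' [D'D simpleD']] := maximal_proper_submod c_series (conj UD nDU).
have [nDD' max_D'] := (simple_subquotP D'D).1 simpleD'.
have DVD : {subset capsm D V <= D} by move=> u; rewrite in_capsm => /andP[].
(* D lies in U + V and U in D', so D = (D \cap V) + D' and D / D' is a factor of V, with index in
   [T]. *)
have DDV : {subset D <= addsm (capsm D V) D'}.
  move=> u uD; have /addsmP[u' u'U [v vV uE]] := NUV _ (DN _ uD).
  apply/addsmP; exists v; last by exists u'; [exact: UD' | rewrite addrC].
  by rewrite in_capsm vV andbT -(addKr u' v) -uE addrC submodB // UD.
have TDV : factors_in s T (capsm D V).
  by apply: factors_in_sub TV => u; rewrite in_capsm => /andP[].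
have [j Tj isoj] := subquot_factors_in DVD DDV TDV D'D simpleD'.
case: (no_arrow j Tj); exists D', D, X; split=> //; last first.
  exact: isomorphic_trans isoD isoN.
move=> Y [D'Y nYD'] [YX nXY].
have [DY|nDY] := pselect {subset D <= Y}.
  by case: (max_D Y DY YX) => // YD u; apply/idP/idP => [/YD|/DY].
(* Either Y lies in D, against the simplicity of D / D', or Y + D = X, so that Y + N = N', against
   the minimality of X. *)
have [||YD|XYD] := max_D (addsm Y D).
- exact: addsmr.
- exact: addsm_sub.
- have YD' : {subset Y <= D} by move=> u uY; apply/YD/addsml.
  by case: (max_D' Y D'Y YD').
case: nXY; apply: min_X => //; split=> [u /UD'/D'Y|u /YX/XN'|] //.
move=> u /N'X; apply: addsm_sub => [x /XYD|]; last exact: addsmr.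
by apply: addsm_sub => [y|d /DN]; [apply: addsml | apply: addsmr].
Qed.

End Splitting.

(** * Connectedness of the lattice digraph *)

Section Connected.
Variables (A : pzRingType) (M : lmodType A).
Variables (n : nat) (c : nat -> submodClosed M).
Hypothesis c_series : composition_series n c.
Variable s : 'I_n -> lmodType A.
Hypothesis s_factor : forall i : 'I_n, isomorphic (subquot (c i.+1) (c i)) (s
  i).

Lemma series_sub k : (k < n)%N -> {subset c k <= c k.+1}.
Proof. by case: c_series => _ _ c_step /c_step[]. Qed.

Lemma series_simple k : (k < n)%N -> simple (subquot (c k.+1) (c k)).
Proof. by case: c_series => _ _ c_step /c_step[]. Qed.

(* Jordan-Hoelder, up to multiplicities. *)
Lemma series_factors_in (N : submodClosed M) : factors_in s (fun=> True) N.
Proof.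
have [c0 cn _] := c_series.
suff: factors_in s (fun=> True) (c n).
  by apply: factors_in_sub => u _; rewrite cn.
suff c_in k : (k <= n)%N -> factors_in s (fun=> True) (c k) by apply: c_in.
elim: k => [_|k IH lt_kn]; first exact: factors_in_zero.
apply: (factors_in_ext (i := Ordinal lt_kn)) (IH (ltnW lt_kn)) => //.
- exact: series_sub.
- exact: series_simple.
- exact: (s_factor (Ordinal lt_kn)).
Qed.

Lemma composition_factor_series (x : lmodType A) :
  composition_factor M x -> simple x /\ exists i, isomorphic (s i) x.
Proof.
case=> m [c' [i [[_ _ c'_step] lt_im isox]]].
have [c'_sub c'_simple] := c'_step i lt_im.
split; first exact: simple_isomorphic isox c'_simple.
have [|j _ isoj] := series_factors_in (N := c' i.+1) c'_sub _ c'_simple => //.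
by exists j; apply: isomorphic_trans isox; apply: isomorphic_sym.
Qed.

Hypothesis s_inj : forall i j, isomorphic (s i) (s j) -> i = j.

(** A nonzero intersection has a simple quotient, whose index would lie in both [S] and [T] because
    the [s i] are pairwise nonisomorphic. *)
Lemma factors_in_disjoint (S T : 'I_n -> Prop) (U V : submodClosed M) :
    (forall i, S i -> ~ T i) -> factors_in s S U -> factors_in s T V ->
  forall w, w \in U -> w \in V -> w = 0.
Proof.
move=> ST SU TV w wU wV; apply: contrapT => w_neq0.
have [c0 _ _] := c_series; pose W := capsm U V.
have c0W : proper_submod (c 0%N) W.
  split=> [u|Wc0]; first by rewrite c0 inE => /eqP->; apply: rpred0.
  have : w \in c 0%N by apply: Wc0; rewrite in_capsm wU.
  by rewrite c0 inE => /eqP.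
have [X _ [XW simpleX]] := maximal_proper_submod c_series c0W.
have [|i Si isoi] := SU _ _ XW _ simpleX; first by move=> u;
  rewrite in_capsm => /andP[].
have [|j Tj isoj] := TV _ _ XW _ simpleX; first by move=> u;
  rewrite in_capsm => /andP[].
apply: (ST i) => //; rewrite (s_inj (isomorphic_trans (isomorphic_sym isoi)
  isoj)) //.
Qed.

Lemma lattice_ext_connected (S : 'I_n -> Prop) :
    indecomposable M ->
    (forall i j, S i -> ~ S j ->
       ~ arrow (lattice_ext_digraph M) (s i) (s j) /\
       ~ arrow (lattice_ext_digraph M) (s j) (s i)) ->
  forall i j, S i -> S j.
Proof.
move=> [_ M_indec] no_arrow i j Si; have [c0 cn _] := c_series.
pose T k := ~ S k.
have addsm_swap (U V : submodClosed M) : {subset addsm U V <= addsm V U}.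
  by apply: addsm_sub => u; [apply: addsmr | apply: addsml].
have split_c k : (k <= n)%N -> exists U V : submodClosed M,
    [/\ {subset U <= c k}, {subset V <= c k}, {subset c k <= addsm U V},
        factors_in s S U & factors_in s T V].
  elim: k => [_|k IH lt_kn].
    exists (c 0%N), (c 0%N); split=> //; first exact: addsml.
      exact: factors_in_zero.
    exact: factors_in_zero.
  have [U [V [Uc Vc cUV SU TV]]] := IH (ltnW lt_kn).
  have sub_k := series_sub lt_kn; have simple_k := series_simple lt_kn.
  have iso_k := s_factor (Ordinal lt_kn).
  (* A new factor from [S] enlarges U; otherwise V is enlarged by the same step with the two roles
     exchanged. *)
  have [Sk|Tk] := pselect (S (Ordinal lt_kn)).
    have [X [Xc cXV SX]] := split_step c_series Sk
      (fun l Tl => (no_arrow _ l Sk Tl).1) Uc cUV Vc SU TV sub_k simple_k iso_k.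
    by exists X, V; split=> // u /Vc/sub_k.
  have [X [Xc cXU TX]] := split_step c_series (S := T) Tk
    (fun l Sl => (no_arrow l _ Sl Tk).2) Vc (fun u uc => addsm_swap _ _ _ (cUV
      u uc))
    Uc TV SU sub_k simple_k iso_k.
  by exists U, X; split=> // u; [move/Uc/sub_k | move/cXU/addsm_swap].
have [U [V [_ _ cUV SU TV]]] := split_c n (leqnn n).
have sub_c (W W' : submodClosed M) k : (forall u, u \in addsm W W') ->
  zero_submod W' ->
    {subset c k <= W}.
  move=> WW' W'0 u _; have /addsmP[w wW [w' w'W' ->]] := WW' u.
  by move: w'W'; rewrite W'0 inE => /eqP->; rewrite addr0.
have UV u : u \in addsm U V by apply: cUV; rewrite cn.
have inS (N : submodClosed M) (S' : 'I_n -> Prop) (k : 'I_n) :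
    factors_in s S' N -> {subset c k.+1 <= N} -> S' k.
  move=> SN cN; have [l Sl isol] := SN _ _ (series_sub (ltn_ord k)) cN
    (series_simple (ltn_ord k)).
  by rewrite (s_inj (isomorphic_trans (isomorphic_sym (s_factor k)) isol)).
(* One summand vanishes and the other is M, which has every factor: V = M would put [i] in [T], so U
   = M and [j] is in [S]. *)
have [||U0|V0] := M_indec U V.
- by move=> w; apply/addsmP.
- by apply: factors_in_disjoint SU TV => k Sk; apply.
- case: (inS V T i TV) => //; apply: sub_c U0 => u; exact: addsm_swap.
- by apply: (inS U S j SU); apply: sub_c V0.
Qed.

End Connected.

(** * From arrows of the lattice to nonzero Ext classes *)

Section ExtLattice.
Variables (K : fieldType) (R : falgType K).
Implicit Types (x y M : lmodType R).

Lemma Ext1_nonzeroP x y :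
  Ext1_nonzero x y <-> exists2 d, is_cocycle d & ~ @is_coboundary _ _ x y d.
Proof.
split=> [[e e_neq0]|[d dZ dB]].
  have [d de] := subquot_proj_surj e.
  exists (val d); first by apply/asboolP/(valP d).
  move=> dB; case/negP: e_neq0; rewrite -de; apply/eqP/subquot_proj_eq0.
  exact/asboolP.
have dZ' : d \in @cocycle _ _ x y by apply/asboolP.
exists (subquot_proj (@cocycle _ _ x y) (@coboundary _ _ x y) (Submod dZ')).
by apply/eqP => /subquot_proj_eq0 /asboolP.
Qed.

Lemma Ext1_dim0 x y : Ext1_dim x y 0 -> ~ Ext1_nonzero x y.
Proof.
move=> [f [g _ gK]] [e /eqP[]].
by rewrite -[e]gK (thinmx0 (g e)) raddf0.
Qed.

Lemma linear_restrict x y (f : {linear x -> y}) :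
  linear (f : restrict x -> restrict y).
Proof. by move=> k u v; rewrite linearP. Qed.

(** Composition with [f] preserves cocycles, and if the result is the coboundary of [h], the
    original cocycle is that of [g \o h]. *)
Lemma Ext1_nonzero_isor x y y' :
  isomorphic y y' -> Ext1_nonzero x y -> Ext1_nonzero x y'.
Proof.
move=> [f [g fK gK]] /Ext1_nonzeroP[d [dl dvl dM] dB]; apply/Ext1_nonzeroP.
have fl := linear_restrict f.
have fZ (a : R) (u : y) : f (a *: u) = a *: f u by rewrite linearZ.
have fD (u v : y) : f (u + v) = f u + f v by rewrite raddfD.
have fB (u v : y) : f (u - v) = f u - f v by rewrite raddfB.
exists (fun a v => f (d a v)); first split.
- by move=> k a b; apply/funext => v; rewrite dl fl.
- by move=> a k u v; rewrite dvl fl.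
- by move=> a b v; rewrite dM [LHS]fD fZ.
case=> h dh; apply: dB.
have gl : linear (g : restrict y' -> restrict y).
  by move=> k u v; apply: (can_inj fK); rewrite fl !gK.
have gl' : linear (g \o h : restrict x -> restrict y).
  by move=> k u v; rewrite /= linearP gl.
pose gL := GRing.isLinear.Build K (restrict x) (restrict y) _ (g \o h) gl'.
pose gh : {linear restrict x -> restrict y} := HB.pack (g \o h) gL.
exists gh => a v; apply: (can_inj fK); rewrite [LHS]dh [RHS]fB fZ.
by rewrite /= !gK.
Qed.

(* A simple module is the image of R under a |-> a v, and a minimal K-subspace
   of R with image x is mapped isomorphically onto x. *)
Lemma simple_section x M (P : M -> Prop) (p : M -> x) :
    simple x -> P 0 ->
    (forall a u v, P u -> P v -> P (a *: u + v)) ->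
    (forall a u v, P u -> P v -> p (a *: u + v) = a *: p u + p v) ->
    (forall w, exists2 u, P u & p u = w) ->
  exists2 sigma : restrict x -> restrict M,
    linear sigma & forall v, P (sigma v) /\ p (sigma v) = v.
Proof.
move=> [[v0 v0_neq0] x_simple] P0 PD pD p_surj.
have [||Q QE] := @submod_comprehension _ _ (fun v => exists a : R, v = a *: v0).
- by exists 0; rewrite scale0r.
- by move=> a _ _ [b ->] [b' ->]; exists (a * b + b'); rewrite scalerDl scalerA.
have gen v : exists a : R, v = a *: v0.
  apply/QE; case: (x_simple Q) => [Q0|->//].
  have : v0 \in Q by apply/QE; exists 1; rewrite scale1r.
  by rewrite (Q0 v0) => /eqP v0_eq0; case/eqP: v0_neq0.
pose covers (C : {vspace R}) := forall v, exists2 a, a \in C & a *: v0 = v.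
have ex_dim : exists k, `[< exists2 C, covers C & \dim C = k >].
  exists (\dim {:R}%VS); apply/asboolP; exists fullv => // v.
  by have [a ->] := gen v; exists a; rewrite ?memvf.
case: (ex_minnP ex_dim) => k /asboolP[C C_cov <-] C_min.
(* If a nonzero [a] in [C] killed [v0], a complement of its line in [C] would still cover x, with
   smaller dimension. *)
have C_inj a : a \in C -> a *: v0 = 0 -> a = 0.
  move=> aC av0; apply/eqP; apply: contraT => a_neq0.
  have : (\dim C <= \dim (C :\: <[a]>)%VS)%N.
    apply: C_min; apply/asboolP; exists (C :\: <[a]>)%VS => // v.
    have [b bC <-] := C_cov v.
    have /memv_addP[b' b'C [_ /vlineP[l ->] ->]]
        : b \in (C :\: <[a]> + <[a]>)%VS.
      by have := addv_diff_cap C <[a]>%VS;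
        rewrite (capv_idPr _) -?memvE // => ->.
    exists b' => //; rewrite scalerDl -[l *: a]mulr_algl -scalerA av0.
    by rewrite scaler0 addr0.
  have := dimv_cap_compl C <[a]>%VS.
  by rewrite (capv_idPr _) -?memvE // dim_vline a_neq0 => <-; rewrite ltnn.
have [u0 Pu0 pu0] := p_surj v0.
have PZ a u : P u -> P (a *: u) by move=> Pu; rewrite -[_ *: u]addr0; apply: PD.
have pZ a u : P u -> p (a *: u) = a *: p u.
  have p0 : p 0 = 0.
    by have := pD (-1) 0 0 P0 P0; rewrite scaler0 addr0 scaleN1r addNr.
  by move=> Pu; have := pD a u 0 Pu P0; rewrite p0 !addr0.
pose t v := s2val (cid2 (C_cov v)).
have tC v : t v \in C by rewrite /t; case: cid2.
have tv v : t v *: v0 = v by rewrite /t; case: cid2.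
have tl (k' : K) u v : t (k'%:A *: u + v) = k' *: t u + t v.
  apply: subr0_eq; apply: C_inj; first by rewrite rpredB ?rpredD ?rpredZ.
  by rewrite scalerBl scalerDl -[k' *: t u]mulr_algl -scalerA !tv subrr.
exists (fun v => t v *: u0) => [l u v|v]; last first.
  by split; [exact: PZ | rewrite pZ // pu0 tv].
rewrite [t _]tl scalerDl; congr (_ + _).
by rewrite -[l *: t u]mulr_algl -scalerA.
Qed.

(* The cocycle of the extension U / W of x = U / V by y = V / W; a coboundary
   would give a submodule V' between W and U other than V. *)
Lemma lattice_ext_Ext1 M x y :
  simple x -> arrow (lattice_ext_digraph M) x y -> Ext1_nonzero x y.
Proof.
move=> x_simple [W [V [U [[[WV nVW] [VU nUV]] V_uniq isox isoy]]]].
have [p p_surj p_ker] := isomorphic_subquot isox.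
have [q q_surj q_ker] := isomorphic_subquot isoy.
(* The projections onto x and y are extended to M by the junk value 0 outside [U] and [V], so that
   one can compute in M without subtypes. *)
pose p' (u : M) : x := if insub u is Some u' then p u' else 0.
pose q' (u : M) : y := if insub u is Some u' then q u' else 0.
have pE u (uU : u \in U) : p' u = p (Submod uU).
  by rewrite /p' insubT; congr (p _); apply: val_inj.
have qE u (uV : u \in V) : q' u = q (Submod uV).
  by rewrite /q' insubT; congr (q _); apply: val_inj.
have pD a u v : u \in U -> v \in U -> p' (a *: u + v) = a *: p' u + p' v.
  move=> uU vU; have wU : a *: u + v \in U by rewrite rpredD ?rpredZ.
  by rewrite !pE -linearP; congr (p _); apply: val_inj.
have qD a u v : u \in V -> v \in V -> q' (a *: u + v) = a *: q' u + q' v.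
  move=> uV vV; have wV : a *: u + v \in V by rewrite rpredD ?rpredZ.
  by rewrite !qE -linearP; congr (q _); apply: val_inj.
have p_ker' u : u \in U -> (p' u = 0) <-> u \in V.
  by move=> uU; rewrite pE p_ker.
have q_ker' u : u \in V -> (q' u = 0) <-> u \in W.
  by move=> uV; rewrite qE q_ker.
have p_surj' w : exists2 u, u \in U & p' u = w.
  have [u <-] := p_surj w; exists (val u); first exact: valP.
  by rewrite (pE _ (valP u)); congr (p _); apply: val_inj.
have q_surj' w : exists2 u, u \in V & q' u = w.
  have [u <-] := q_surj w; exists (val u); first exact: valP.
  by rewrite (qE _ (valP u)); congr (q _); apply: val_inj.
have UD (a : R) u v : u \in U -> v \in U -> a *: u + v \in U.
  by move=> uU vU; rewrite rpredD ?rpredZ.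
have [sg sgl sgP] := @simple_section x M (fun u => u \in U) p' x_simple
  (rpred0 _) UD pD p_surj'.
have sgU v : (sg v : M) \in U by case: (sgP v).
have psg v : p' (sg v) = v by case: (sgP v).
have pB u v : u \in U -> v \in U -> p' (u - v) = p' u - p' v.
  by move=> uU vU; rewrite addrC -scaleN1r pD // scaleN1r addrC.
have p0 : p' 0 = 0 by apply/p_ker'; rewrite rpred0.
have q0 : q' 0 = 0 by apply/q_ker'; rewrite rpred0.
have pZ a u : u \in U -> p' (a *: u) = a *: p' u.
  by move=> uU; rewrite -[a *: u]addr0 pD ?rpred0 // p0 addr0.
have qZ a u : u \in V -> q' (a *: u) = a *: q' u.
  by move=> uV; rewrite -[a *: u]addr0 qD ?rpred0 // q0 addr0.
have sgD k (u v : x) : sg (k%:A *: u + v) = k%:A *: (sg u : M) + sg v by apply: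
  sgl.
have algC (N : lmodType R) k a (u : N) : a *: (k%:A *: u) = k%:A *: (a *: u).
  by rewrite !scalerA mulr_algl mulr_algr.
have algA (N : lmodType R) k a (u : N) : (k *: a) *: u = k%:A *: (a *: u).
  by rewrite scalerA mulr_algl.
(* The defect of R-linearity of the K-linear section [sg]; it is killed by [p'], hence lies in [V],
   and its image under [q'] is the cocycle. *)
pose D a (v : x) : M := a *: (sg v : M) - sg (a *: v).
have D_V a v : D a v \in V.
  by apply/p_ker'; rewrite ?submodB ?rpredZ // pB ?rpredZ // pZ // !psg subrr.
have DDl k a b v : D (k *: a + b) v = k%:A *: D a v + D b v.
  by rewrite /D !scalerDl (algA M k a) (algA x k a) sgD scalerBr opprD addrACA.
have DDr k a u v : D a (k%:A *: u + v) = k%:A *: D a u + D a v.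
  by rewrite /D sgD !scalerDr !algC sgD scalerN opprD addrACA.
have DM a b v : D (a * b) v = a *: D b v + D a (b *: v).
  by rewrite /D scalerBr !scalerA addrA subrK.
pose d (a : R) (v : restrict x) : restrict y := q' (D a v).
apply/Ext1_nonzeroP; exists d; first split.
- by move=> k a b; apply/funext => v; rewrite /d DDl qD.
- by move=> a k u v; rewrite /d [D _ _]DDr qD.
- by move=> a b v; rewrite /d DM qD.
case=> h dh.
have hD k (u v : x) : h (k%:A *: u + v) = k%:A *: (h u : y) + h v.
  exact: (linearP h).
have h0 : h 0 = 0 by rewrite raddf0.
have hD1 (u v : x) : h (u + v) = (h u : y) + h v by rewrite raddfD.
(* The component in [V] for the K-space decomposition of [U] into [V] and the image of [sg]. *)
pose r u : M := u - sg (p' u).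
have r_V u : u \in U -> r u \in V.
  by move=> uU; apply/p_ker'; rewrite ?submodB // pB // psg subrr.
have sgD1 (u v : x) : sg (u + v) = (sg u : M) + sg v.
  by have := sgD 1 u v; rewrite !scale1r.
have sg0 : sg 0 = 0 :> M.
  by apply: (addrI (sg 0 : M)); rewrite -sgD1 !addr0.
have qD1 u v : u \in V -> v \in V -> q' (u + v) = q' u + q' v.
  by move=> uV vV; have := qD 1 _ _ uV vV; rewrite !scale1r.
have rZD a u v : u \in U -> v \in U ->
    r (a *: u + v) = a *: r u + (D a (p' u) + r v).
  move=> uU vU; rewrite /r /D pD // sgD1 scalerBr opprD [RHS]addrA.
  by rewrite [a *: u - _ + _]addrA subrK [RHS]addrACA.
have qrE u : (q' (r u) + h (p' u) = 0 :> y) -> q' (r u) = - (h (p' u) : y).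
  by move/eqP; rewrite addr_eq0 => /eqP.
(* The sum of [q' (r u)] and [h (p' u)] is R-linear in u, since the coboundary equation cancels the
   defect [D]. It restricts to [q'] on [V], so its kernel meets [V] in [W]. *)
have [||V' V'E] := @submod_comprehension _ M
    (fun u => u \in U /\ (q' (r u) + h (p' u) = 0 :> y)).
- by rewrite /r p0 h0 sg0 subrr q0 addr0; split; rewrite ?rpred0.
- move=> a u v [uU /qrE ru] [vU /qrE rv]; split; first exact: UD.
  have ruV := r_V _ uU; have rvV := r_V _ vU.
  rewrite rZD // qD ?(rpredD (D_V _ _)) // (qD1 (D a _)) // pD // hD1 ru rv.
  rewrite -[q' (D a _)]/(d a (p' u)) dh scalerN.
  by rewrite -addrA -[_ - _ - _]addrA -opprD subrK addNr.
have r_of_V u : u \in V -> r u = u - sg 0.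
  by move=> uV; rewrite /r (_ : p' u = 0) //; apply/p_ker' => //; apply: VU.
have V'V u : u \in V -> (u \in V') <-> (u \in W).
  move=> uV; have uU := VU _ uV; have pu0 : p' u = 0 by apply/p_ker'.
  by rewrite V'E r_of_V // sg0 subr0 pu0 h0 addr0;
    split=> [[_ /(q_ker' _ uV)]|/(q_ker' _ uV)].
have WV' : {subset W <= V'} by move=> u uW; apply/V'V => //; apply: WV.
have [[v v_neq0] _] := x_simple.
(* Correcting [sg v] by a lift of [h v] gives an element of V' outside V. *)
have [t tV qt] := q_surj' (h v).
pose u := (sg v : M) - t.
have tU := VU _ tV.
have uU : u \in U by rewrite submodB.
have pu : p' u = v by rewrite pB // psg (p_ker' _ tU).2 ?subr0.
have uV' : u \in V'.
  apply/V'E; split=> //; rewrite pu /r pu /u addrAC subrr add0r.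
  by rewrite -scaleN1r qZ // scaleN1r qt addNr.
have uV : u \notin V.
  by apply/negP => /(p_ker' _ uU)/eqP; rewrite pu (negPf v_neq0).
have [z zV zW] := not_subset_ex nVW.
have : V' =i V; last by move=> V'V0; case/negP: uV; rewrite -V'V0.
apply: V_uniq; split=> //.
- by move=> V'W; case/negP: uV; apply/WV/V'W.
- by move=> ? /V'E[].
- by move=> UV'; case/negP: zW; apply/V'V => //; apply/UV'/VU.
Qed.
End ExtLattice.

(** * Multiplicity freeness, and closing a cycle in the Ext quiver *)

Lemma multiplicity_free_inj (A : pzRingType) (M : lmodType A) n
    (c : nat -> submodClosed M) (s : 'I_n -> lmodType A) :
    multiplicity_free M -> composition_series n c ->
    (forall i : 'I_n, isomorphic (subquot (c i.+1) (c i)) (s i)) ->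
  forall i j, isomorphic (s i) (s j) -> i = j.
Proof.
move=> M_mf c_series s_factor i j isoij; apply: val_inj => /=.
have iso : isomorphic (subquot (c i.+1) (c i)) (subquot (c j.+1) (c j)).
  apply: isomorphic_trans (s_factor i) _.
  exact: isomorphic_trans isoij (isomorphic_sym (s_factor j)).
case: (ltngtP i j) => // [lt_ij|lt_ji].
  by case: (M_mf n c c_series i j); rewrite ?lt_ij ?ltn_ord.
case: (M_mf n c c_series j i); rewrite ?lt_ji ?ltn_ord //.
exact: isomorphic_sym.
Qed.

Theorem corollary3p3 (K : closedFieldType) (R : falgType K) (M : lmodType R) :
  acyclic_ext_quiver R ->
  finite_length M ->
  indecomposable M ->
  multiplicity_free M ->
  same_digraph (lattice_ext_digraph M)
    (induced (ext_digraph R) (composition_factor M)).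
Proof.
move=> [no_loop no_multi no_cycle] [n [c c_series]] M_indec M_mf.
split=> // x y Mx My /=.
have S_factor (i : 'I_n) := isomorphic_refl (subquot (c i.+1) (c i)).
have [x_simple [i Si]] := composition_factor_series c_series S_factor Mx.
have [y_simple [j Sj]] := composition_factor_series c_series S_factor My.
split=> [|Exy]; first exact: (lattice_ext_Ext1 x_simple).
(* An isomorphism would turn the extension of x by y into a self-extension of x, that is, a loop. *)
have nxy : ~ isomorphic x y.
  move/isomorphic_sym/Ext1_nonzero_isor/(_ Exy).
  exact: Ext1_dim0 (no_loop x x_simple).
have ji : j != i.
  apply/eqP => ji; apply: nxy; apply: isomorphic_trans (isomorphic_sym Si) _.
  by rewrite -ji.
(* Putting x and y themselves among the factors avoids transporting Ext^1
   along isomorphisms. *)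
pose s k : lmodType R :=
  if k == i then x else if k == j then y else subquot (c k.+1) (c k).
have si : s i = x by rewrite /s eqxx.
have sj : s j = y by rewrite /s (negPf ji) eqxx.
have s_factor (k : 'I_n) : isomorphic (subquot (c k.+1) (c k)) (s k).
  rewrite /s; case: eqP => [->//|_]; case: eqP => [->//|_].
  exact: isomorphic_refl.
have s_simple k : simple (s k).
  exact: simple_isomorphic (s_factor k) (series_simple c_series (ltn_ord k)).
have s_inj := multiplicity_free_inj M_mf c_series s_factor.
pose a k l := arrow (lattice_ext_digraph M) (s k) (s l).
pose e k l := `[< a k l \/ a l k >].
have e_ext k l : e k l -> Ext1_nonzero (s k) (s l) \/ Ext1_nonzero (s l) (s k).
  by move=> /asboolP[] /lattice_ext_Ext1; [left | right]; auto.
have conn : connect e i j.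
  (* The set reachable from [i] is joined to its complement by no arrow in either direction, so it
     contains [j]. *)
  apply: (lattice_ext_connected c_series s_factor s_inj (S := connect e i)
    M_indec) (connect0 e i).
  move=> k l ik /negP il; split=> akl; case/negP: il;
    apply: connect_trans ik (connect1 _).
    by apply/asboolP; left.
  by apply/asboolP; right.
have [q e_q] := connectP conn.
case/shortenP: e_q => -[|k [|l p]] e_p uniq_p _ /= last_p.
- by rewrite last_p eqxx in ji.
(* A path of one edge is either the desired arrow or an arrow from y to x; the latter makes Ext
   nonzero both ways, a double edge. *)
- move: e_p; rewrite /= andbT -last_p => /asboolP;
    rewrite /a si sj => -[//|/(lattice_ext_Ext1 y_simple) Eyx].
  have [m [m' [dim_m dim_m' le1]]] := no_multi x y x_simple y_simple nxy.
  case: m dim_m le1 => [/Ext1_dim0 // |m _];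
    case: m' dim_m' => [/Ext1_dim0 //|m' _].
  by rewrite addnS.
(* The path now has at least three distinct vertices, which form a cycle once [Exy] joins its
   ends. *)
set r := i :: _ in uniq_p.
pose t (h : 'I_(size r)) := s (nth i r h).
case: (no_cycle _ t) => // [h|h h' /s_inj/eqP|h]; first exact: s_simple.
  by rewrite nth_uniq ?ltn_ord // => /eqP/val_inj.
have [lt_h|ge_h] := ltnP h.+1 (size r).
  have e_h : e (nth i r h) (nth i r h.+1) by apply: (pathP i e_p).
  by have := e_ext _ _ e_h; rewrite /t /= modn_small.
(* At the last index [ordS] wraps around from [j] to [i], and the closing edge is [Exy] read
   backwards. *)
have eq_h : h.+1 = size r by apply/eqP; rewrite eqn_leq ltn_ord.
right; rewrite /t /= eq_h modnn /= si.
suff -> : nth i r h = j by rewrite sj.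
by rewrite last_p (last_nth i) -[h : nat]/(h.+1.-1) eq_h.
Qed.
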